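(* Let $t$ be a positive integer and let $G$ be a connected simple graph of order $n\geq 5$ with minimum degree $\delta(G)\geq t$. Suppose that $$|E(G)|>\binom{n-t}{2}+\frac32t^2-t+\frac12 \quad\text{if } n=5 \text{ or } n\geq 6t+1,$$ and $$|E(G)|>\binom{n-t}{2}+\frac32t^2+\frac t2 \quad\text{if } 6\leq n\leq 6t.$$ Then $G$ has a spanning tree with leaf distance at least four.
   Context: All graphs are finite, simple, undirected. A leaf of a tree is a vertex of degree one. The leaf distance of a tree $T$ is the minimum distance in $T$ between any two distinct leaves of $T$. A spanning tree of $G$ is a spanning subgraph of $G$ that is a tree. *)

(* Defs.v *)
From HB Require Import structures.
From mathcomp Require Import all_boot all_order all_algebra.
Set Implicit Arguments.
Unset Strict Implicit.
Unset Printing Implicit Defensive.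

Section Graphs.
Variable V : finType.
Implicit Types (e f : rel V) (x y : V).

Definition simple_graph e : Prop := symmetric e /\ irreflexive e.

Definition edges e : {set {set V}} :=
  [set A | [exists x, exists y, e x y && (A == [set x; y])]].

Definition degree e x : nat := #|[set y | e x y]|.

(* Degrees in a simple graph are < #|V|, so the neutral element #|V| is only
   reached when V is empty. *)
Definition min_degree e : nat := \big[minn/#|V|]_(x : V) degree e x.

Definition connected e : Prop := forall x y, connect e x y.

(* For symmetric e, a duplicate-free cyclic e-sequence of length at most 2 is
   not a cycle of the graph, hence the bound on the size. *)
Definition acyclic e : Prop :=
  forall c : seq V, 2 < size c -> ~ ucycle e c.

Definition is_tree e : Prop := [/\ simple_graph e, connected e & acyclic e].

Definition spanning_tree e f : Prop := subrel f e /\ is_tree f.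

Definition leaf f x : bool := degree f x == 1.

Definition walk_of_length e x y (k : nat) : bool :=
  [exists p : k.-tuple V, path e x p && (last x p == y)].

(* Least length of a walk from x to y. A shortest walk has length < #|V|; the
   value is #|V| when y is not reachable from x. *)
Definition dist e x y : nat := find (walk_of_length e x y) (iota 0 #|V|).

(* Distances in a connected graph are < #|V|, so the neutral element #|V| is
   only reached when there are no two distinct leaves, which for a tree means
   that it has a single vertex. *)
Definition leaf_distance f : nat :=
  \big[minn/#|V|]_(p : V * V | [&& leaf f p.1, leaf f p.2 & p.1 != p.2])
    dist f p.1 p.2.

End Graphs.

(* Main.v *)
(* The edge bound is so strong that G has a Hamiltonian path, whose two leaves
   are at distance n - 1 >= 4.  G has a Hamiltonian path iff its cone (G plus a
   universal vertex) has a Hamiltonian cycle, and by Chvatal's argument a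
   non-Hamiltonian graph of order N and minimum degree at least d has, for some
   d <= k < N / 2, degree sum at most N^2 - N - 2kN + 3k^2 + k.  For the cone,
   N = n + 1 and d = t + 1, which contradicts the assumed number of edges. *)
Require Import Defs.
From Stdlib Require Import Classical.
From HB Require Import structures.
From mathcomp Require Import all_boot all_order all_algebra.
From mathcomp Require Import zify lra.
Set Implicit Arguments.
Unset Strict Implicit.
Unset Printing Implicit Defensive.
Import Order.TTheory GRing.Theory Num.Theory.

(** * Hamiltonian cycles and added edges *)

Definition hamiltonian (W : finType) (e : rel W) : Prop :=
  exists2 c, ucycle e c & size c = #|W|.

Definition add_edge (W : eqType) (e : rel W) (u v : W) : rel W :=
  fun x y => [|| e x y, (x == u) && (y == v) | (x == v) && (y == u)].

Section Hamiltonicity.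
Variable W : finType.
Implicit Types (e : rel W) (u v x y : W).

Lemma add_edge_simple e u v :
  simple_graph e -> u != v -> simple_graph (add_edge e u v).
Proof.
move=> [se ie] uv; split=> [x y|x]; rewrite /add_edge.
  by rewrite se; do !case: eqP => //= _; rewrite ?orbT ?orbF.
rewrite ie /=; apply/negP; case/orP=> /andP[/eqP-> /eqP E];
  by rewrite E eqxx in uv.
Qed.

Lemma add_edgeC e u v : add_edge e u v =2 add_edge e v u.
Proof. by move=> x y; rewrite /add_edge; congr (_ || _); rewrite orbC. Qed.

Lemma uniq_full_mem (s : seq W) x : uniq s -> size s = #|W| -> x \in s.
Proof.
move=> us ss; have: #|s| == #|W| by rewrite (card_uniqP us) ss.
by move=> H; have/subset_cardP := eqP H; move=> /(_ (subset_predT _)) ->.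
Qed.

(* The rotation argument: if u is adjacent to some x and v to the successor of
   x on the path, then reversing the tail after x closes the path to a cycle. *)
Lemma hamiltonian_of_path e u v (p : seq W) :
  simple_graph e -> path e v p -> last v p = u -> uniq (v :: p) ->
  size (v :: p) = #|W| -> #|W| <= degree e u + degree e v -> hamiltonian e.
Proof.
move=> [se ie] pp lp up sp dd.
set s := v :: p.
have ins x : x \in s by apply: uniq_full_mem.
have ns : injective (next s) by apply: (can_inj (prev_next up)).
have fc : path (frel (next s)) v (rcons p v) by apply: (cycle_next up).
have nu : next s u = v by move: fc; rewrite rcons_path lp => /andP[_ /eqP].
(* [X] and [Y] both miss [u], as [next s u = v] and [e] is irreflexive; were they disjoint, the
   degree sum would be at most [#|W| - 1]. Since [next s] is injective, [Y] has as many elements as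
   [v] has neighbours. *)
pose X := [set x | e u x]; pose Y := [set x | e v (next s x)].
have cY : #|Y| = degree e v.
  rewrite /degree -[RHS](card_preimset _ ns).
  by apply: eq_card => x; rewrite !inE.
have : X :&: Y != set0.
  apply/negP => /eqP XY0.
  have : #|X :|: Y| <= #|[set~ u]|.
    apply: subset_leq_card; apply/subsetP => x; rewrite !inE.
    by case/orP => H; apply/eqP => E; rewrite E ?nu ie in H.
  rewrite cardsU XY0 cards0 subn0 cY cardsC1 -/(degree e u).
  have W0 : 0 < #|W| by apply/card_gt0P; exists u.
  rewrite /X -/(degree e u); lia.
case/set0Pn => x; rewrite !inE => /andP[eux evn].
have xu : x != u by apply: contraTneq eux => ->; rewrite ie.
have [A [z [B [Ep lA nz]]]] :
    exists A z B, [/\ p = A ++ z :: B, last v A = x & next s x = z].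
  have := ins x; case/splitPl Es: p / => [A B lA].
  case: B Es => [|z B] Es.
    by move: lp xu; rewrite Es cats0 lA => ->; rewrite eqxx.
  exists A, z, B; split => //; apply/eqP.
  by move: fc; rewrite Es rcons_cat cat_path lA => /and3P[].
rewrite nz in evn.
exists ((v :: A) ++ rev (z :: B)); last first.
  by rewrite size_cat size_rev -size_cat /= -Ep.
apply/andP; split; last first.
  by move: up; rewrite Ep -cat_cons !cat_uniq rev_uniq has_rev.
move: pp lp; rewrite Ep last_cat cat_path lA /= => /and3P[pA exz pB] lB.
rewrite rcons_cat cat_path pA lA /= lastI rev_rcons lB /= se eux /=.
rewrite rcons_path -lB rev_path (eq_path (e' := e)) ?pB //=.
have -> : last (last z B) (rev (belast z B)) = z.
  by rewrite -(last_cons z) -rev_rcons -lastI rev_cons last_rcons.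
by rewrite se.
Qed.

(** Cutting the cycle between [u] and [v] leaves a path from [v] to [u]. It avoids the added edge:
    [v] occurs only at its start, and the second vertex is not [u] because there are more than two
    vertices. *)
Lemma hamiltonian_add_edge_oriented e u v c :
  simple_graph e -> u != v -> 2 < #|W| -> #|W| <= degree e u + degree e v ->
  cycle (add_edge e u v) c -> uniq c -> size c = #|W| -> next c u = v ->
  hamiltonian e.
Proof.
move=> se uv W3 dd cc uc sc nu.
have [i p rp] := rot_to (uniq_full_mem v uc sc).
rewrite -(rot_cycle i) in cc; rewrite -(rot_uniq i) in uc.
rewrite -(size_rot i) in sc; rewrite -(next_rot i) ?rot_uniq in nu; last first.
  by rewrite rot_uniq in uc.
rewrite {}rp in cc uc sc nu.
have fc : path (frel (next (v :: p))) v (rcons p v) by apply: (cycle_next uc).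
have lp : last v p = u.
  apply: (can_inj (prev_next uc)); rewrite nu.
  by move: fc; rewrite rcons_path => /andP[_ /eqP].
apply: (@hamiltonian_of_path e u v p) => //.
move: cc; rewrite /cycle rcons_path => /andP[+ _].
case: p {fc nu} uc sc lp => [|y [|z q]].
  by move=> _ /= E; rewrite -E in W3.
  by move=> _ /= E; rewrite -E in W3.
set q' := z :: q => uc sc lp /= /andP[vy pq].
move: uc => /=; rewrite inE negb_or => /and3P[/andP[vNy vq] yq _].
have yu : y != u.
  by apply: contra yq => /eqP->; rewrite -lp /= mem_last.
apply/andP; split.
  case/orP: vy => // /orP[] /andP[/eqP E /eqP E'].
    by rewrite E eqxx in uv.
  by rewrite E' eqxx in yu.
rewrite -/(path e y q'); have {}pq : path (add_edge e u v) y q' := pq.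
apply: (sub_in_path (P := mem (predC1 v))) pq.
  move=> a b; rewrite !inE => av bv /orP[] // /orP[] /andP[].
    by rewrite (negbTE bv).
  by rewrite (negbTE av).
apply/allP => a; rewrite in_cons => /orP[/eqP->|aq] /=; first by rewrite eq_sym.
by apply: contra vq => /eqP <-.
Qed.

(* Bondy and Chvatal's closure step. *)
Lemma hamiltonian_add_edge e u v :
  simple_graph e -> u != v -> 2 < #|W| -> #|W| <= degree e u + degree e v ->
  hamiltonian (add_edge e u v) -> hamiltonian e.
Proof.
move=> se uv W3 dd [c /andP[cc uc] sc].
(* Either the cycle already lies in [e], or it traverses the added edge in one of the two
   directions. *)
have [/allP ce|] := boolP (all (fun x => e x (next c x)) c).
  by exists c => //; rewrite /ucycle uc cycle_from_next.
case/allPn => x xc ne; have := next_cycle cc xc.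
rewrite /add_edge (negbTE ne) /= => /orP[] /andP[/eqP xE /eqP nE]; subst x.
  exact: (hamiltonian_add_edge_oriented se uv W3 dd cc uc sc nE).
rewrite addnC in dd; rewrite eq_sym in uv.
rewrite (eq_cycle (add_edgeC e u v)) in cc.
exact: (hamiltonian_add_edge_oriented se uv W3 dd cc uc sc nE).
Qed.

Lemma hamiltonian_complete e :
  2 < #|W| -> (forall x y, x != y -> e x y) -> hamiltonian e.
Proof.
move=> W3 ce; exists (enum W); last by rewrite -cardE.
rewrite /ucycle enum_uniq andbT; apply: cycle_from_next; first exact: enum_uniq.
move=> x xW; apply: ce.
have [i p rp] := rot_to xW.
have ue := enum_uniq W; have sz : size (rot i (enum W)) = #|W|.
  by rewrite size_rot -cardE.
rewrite -(next_rot i ue); move: ue; rewrite -(rot_uniq i); rewrite {}rp in sz *.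
case: p sz => [/= sz|y p _ ue]; first by rewrite -sz in W3.
have := cycle_next ue; rewrite /cycle rcons_cons.
case/andP=> /eqP-> _; move: ue => /=; rewrite inE negb_or.
by case/andP=> /andP[].
Qed.

(** * Chvatal's bound on the degree sum *)

Lemma degree_lt e x : irreflexive e -> degree e x < #|W|.
Proof.
move=> ie; rewrite -[#|W|](cardsT W); apply: proper_card.
by apply/properP; split; [apply: subsetT | exists x; rewrite !inE // ie].
Qed.

(** By maximality of the pair, each nonneighbour of [u] has degree at most that of [v], and each
    nonneighbour of [v] other than [v] has degree at most that of [u]. *)
Lemma degree_sum_of_max_nonadjacent e u v :
  simple_graph e -> degree e u + degree e v < #|W| ->
  degree e u <= degree e v -> u != v -> ~~ e u v ->
  (forall x y, x != y -> ~~ e x y ->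
     degree e x + degree e y <= degree e u + degree e v) ->
  \sum_x degree e x + 2 * degree e u * #|W| + #|W| <=
    #|W| ^ 2 + 3 * degree e u ^ 2 + degree e u.
Proof.
move=> [se ie] dd duv uv nuv mx; set k := degree e u.
pose A := [set x | (x != v) && ~~ e v x]; pose B := [set x | ~~ e u x].
have cB : #|B| + k = #|W|.
  rewrite -(cardsC [set x | e u x]) addnC; congr (_ + _).
  by apply: eq_card => x; rewrite !inE.
have cA : #|A| + degree e v + 1 = #|W|.
  have -> : A = ~: [set x | e v x] :\ v by apply/setP => x; rewrite !inE.
  have := cardsD1 v (~: [set x | e v x]); have := cardsC [set x | e v x].
  rewrite !inE ie /= /degree; lia.
(* Off u, a vertex of B has degree at most deg v <= N - 1 - k, and a vertex of A
   has degree at most k; these give the weights subtracted from N - 1. *)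
have Bsum : \sum_x ((x \in B) * k + (x \in A) * (#|W| - 1 - 2 * k)) =
    #|B| * k + #|A| * (#|W| - 1 - 2 * k).
  rewrite big_split /= -!big_distrl /=.
  by congr (_ * _ + _ * _); rewrite -[RHS]sum1_card [RHS]big_mkcond;
    apply: eq_bigr => x _; case: (x \in _).
have : \sum_x (degree e x + ((x \in B) * k + (x \in A) * (#|W| - 1 - 2 * k)))
    <= \sum_(x : W) (#|W| - 1).
  apply: leq_sum => x _; have dx := degree_lt x ie.
  have dA : x \in A -> degree e x <= k.
    rewrite !inE => /andP[xv nvx]; have := mx x v xv.
    rewrite se nvx => /(_ isT).
    rewrite /k; lia.
  have dB : x \in B -> degree e x <= #|W| - 1 - k.
    rewrite inE => nux; have [->|xu] := eqVneq x u; first by rewrite -/k; lia.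
    by have := mx u x; rewrite eq_sym xu nux => /(_ isT isT); rewrite /k; lia.
  (* On the intersection of [A] and [B] the weights add up to [N - 1 - k], which matches the bound
     [k] on the degree. *)
  by case: (x \in A) dA => [/(_ isT)|_]; case: (x \in B) dB => [/(_ isT)|_];
    rewrite ?mul1n ?mul0n; rewrite -/k in dd; lia.
rewrite big_split /= Bsum sum_nat_const; move: cB cA.
set S := \sum_x _; set N := #|W|; set a := #|A|; set b := #|B|.
rewrite -/k in dd duv *; rewrite -/N in dd.
move=> cB cA H.
(* [A] has [N - 1 - deg v] elements, and the degree sum of [u] and [v] is below [N]. *)
have ka : k <= a by lia.
have : k * (N - 1 - 2 * k) <= a * (N - 1 - 2 * k) by rewrite leq_mul2r ka orbT.
(* The slack [m] replaces all truncated subtractions. *)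
have [m Nm] : exists m, N = 2 * k + 1 + m by exists (N - 1 - 2 * k); lia.
have bE : b = k + 1 + m by lia.
move: H; rewrite bE Nm.
have -> : 2 * k + 1 + m - 1 - 2 * k = m by lia.
have -> : 2 * k + 1 + m - 1 = 2 * k + m by lia.
rewrite -!mulnn; lia.
Qed.

(* Adding an edge between nonadjacent vertices of degree sum >= N preserves
   non-Hamiltonicity and only increases degrees, so one may assume that every
   nonadjacent pair has degree sum < N; the pair maximizing it gives k. *)
Lemma nonhamiltonian_degree_sum e d :
  simple_graph e -> 2 < #|W| -> ~ hamiltonian e ->
  (forall x, d <= degree e x) ->
  exists k, [/\ d <= k, 2 * k < #|W| &
    \sum_x degree e x + 2 * k * #|W| + #|W| <= #|W| ^ 2 + 3 * k ^ 2 + k].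
Proof.
move=> + W3.
(* Induction on the number of nonadjacent ordered pairs, which drops when an edge is added. *)
have [m] := ubnP #|[pred p : W * W | ~~ e p.1 p.2]|.
elim: m e => // m IH e lm se nh hd.
pose P (p : W * W) := (p.1 != p.2) && ~~ e p.1 p.2.
have [p0 P0|P0] := pickP P; last first.
  case: nh; apply: hamiltonian_complete => // x y xy.
  by have := P0 (x, y); rewrite /P /= xy => /negbFE.
have [[u v] /= /andP[/= uv nuv] mx] :
    exists2 p, P p & forall q, P q ->
      degree e q.1 + degree e q.2 <= degree e p.1 + degree e p.2.
  by case: (arg_maxnP (fun p => degree e p.1 + degree e p.2) P0) => p; exists p.
have [dd|dd] := leqP #|W| (degree e u + degree e v).
  have dm x : degree e x <= degree (add_edge e u v) x.
    by apply/subset_leq_card/subsetP => y; rewrite !inE /add_edge => ->.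
  have [||||k [dk kW H]] := IH (add_edge e u v).
  - rewrite -ltnS; apply: leq_trans lm; rewrite ltnS; apply: proper_card.
    apply/properP; split.
      by apply/subsetP => -[x y]; rewrite !inE /= /add_edge negb_or => /andP[].
    by exists (u, v); rewrite !inE //= /add_edge !eqxx orbT.
  - exact: add_edge_simple.
  - by move=> h; apply: nh; apply: hamiltonian_add_edge h.
  - by move=> x; apply: leq_trans (dm x).
  exists k; split=> //; apply: leq_trans H; rewrite !leq_add2r.
  exact: leq_sum.
wlog duv : u v uv nuv mx dd / degree e u <= degree e v.
  move=> G; have [duv|/ltnW dvu] := leqP (degree e u) (degree e v).
    exact: (G u v).
  apply: (G v u) => //; [by rewrite eq_sym|by rewrite se.1| |by rewrite addnC].
  by move=> q /mx /=; rewrite [X in _ <= X -> _]addnC.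
exists (degree e u); split; first exact: hd.
  by apply: leq_ltn_trans dd; rewrite mul2n -addnn leq_add2l.
apply: (degree_sum_of_max_nonadjacent se dd duv uv nuv) => x y xy nxy.
by apply: (mx (x, y)); rewrite /P /= xy.
Qed.

End Hamiltonicity.

(** * Edge counting and the cone *)

Section SpanningPath.
Variable V : finType.
Implicit Types (e : rel V) (x y : V).

(** Double counting of incidences: each edge has two ends, and sending [y] to [[set x; y]] maps the
    neighbours of [x] onto the edges through [x]. *)
Lemma double_edges_le e :
  simple_graph e -> 2 * #|edges e| <= \sum_x degree e x.
Proof.
move=> [se ie].
have -> : 2 * #|edges e| = \sum_(A in edges e) \sum_x (x \in A : nat).
  rewrite mulnC -sum_nat_const; apply: eq_bigr => A.
  rewrite inE => /existsP[x /existsP[y /andP[exy /eqP->]]].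
  have xy : x != y by apply: contraTneq exy => ->; rewrite ie.
  have c2 : #|[set x; y]| = 2 by rewrite cards2 xy.
  rewrite -[LHS]c2 -sum1_card big_mkcond.
  by apply: eq_bigr => z _; case: ifP.
rewrite exchange_big /=; apply: leq_sum => x _.
apply: leq_trans (leq_imset_card (fun y => [set x; y]) [set y | e x y]).
have -> : \sum_(A in edges e) (x \in A : nat) = #|[set A in edges e | x \in A]|.
  by rewrite -sum1dep_card big_mkcondr; apply: eq_bigr => A _; case: ifP.
apply: subset_leq_card; apply/subsetP => A; rewrite !inE.
case/andP=> /existsP[a /existsP[b /andP[eab /eqP->]]].
rewrite !inE => /orP[] /eqP->; apply/imsetP.
  by exists b; rewrite ?inE.
by exists a; rewrite ?inE 1?se // setUC.
Qed.

Definition cone e : rel (option V) := fun a b =>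
  match a, b with
  | Some x, Some y => e x y
  | None, None => false
  | _, _ => true
  end.

Lemma cone_simple e : simple_graph e -> simple_graph (cone e).
Proof. by move=> [se ie]; split=> [[x|] [y|]|[x|]] //=; apply: se. Qed.

Lemma degree_cone_None e : degree (cone e) None = #|V|.
Proof.
rewrite /degree -cardsT -[RHS](card_imset _ (@Some_inj _)).
apply: eq_card => -[y|].
  by rewrite inE /= imset_f.
by rewrite inE /=; apply/esym/negP => /imsetP[].
Qed.

Lemma degree_cone_Some e x : degree (cone e) (Some x) = (degree e x).+1.
Proof.
rewrite /degree (cardsD1 None) inE /= add1n; congr _.+1.
rewrite -(card_imset [set y | e x y] (@Some_inj _)); apply: eq_card => -[y|].
  rewrite !inE /=; apply/idP/imsetP => [exy|[z + [->]]]; last by rewrite inE.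
  by exists y; rewrite ?inE.
by rewrite !inE /=; apply/esym/negP => /imsetP[].
Qed.

Lemma degree_sum_cone e :
  \sum_a degree (cone e) a = \sum_x degree e x + 2 * #|V|.
Proof.
rewrite (bigD1 None) //= degree_cone_None.
rewrite (reindex_omap Some id) /=; last by case.
rewrite (eq_bigl predT) => [|x]; last by rewrite eqxx.
rewrite (eq_bigr _ (fun x _ => degree_cone_Some e x)).
under eq_bigr do rewrite -addn1.
rewrite big_split /= sum_nat_const muln1.
rewrite (_ : #|_| = #|V|) //; lia.
Qed.

(** Rotate the cycle to start at the apex [None] and delete the apex. *)
Lemma hamiltonian_path_of_cone e :
  hamiltonian (cone e) -> exists p, [/\ sorted e p, uniq p & size p = #|V|].
Proof.
case=> c /andP[cc uc] sc; have [i q rc] := rot_to (uniq_full_mem None uc sc).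
rewrite -(rot_cycle i) in cc; rewrite -(rot_uniq i) in uc.
rewrite -(size_rot i) card_option in sc; rewrite {}rc in cc uc sc.
move: uc; rewrite cons_uniq => /andP[Nq uq].
have [p qE] : exists p, q = map Some p.
  elim: q Nq {cc uq sc} => [|[x|] q IH]; first by exists [::].
    by rewrite in_cons => /IH[p ->]; exists (x :: p).
  by rewrite in_cons eqxx.
exists p; subst q; split; last 1 first.
- by case: sc; rewrite size_map.
- move: cc; rewrite /cycle rcons_path => /andP[/path_sorted + _].
  by rewrite sorted_map.
by rewrite (map_inj_uniq (@Some_inj _)) in uq.
Qed.

(** Adjacency is encoded by positions in [p], which turns the facts about the path into arithmetic
    on indices. *)
Definition path_graph (p : seq V) : rel V := fun x y =>
  (index y p == (index x p).+1) || (index x p == (index y p).+1).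

(** * The path as a spanning tree, and its leaf distance *)

Section PathGraph.
Variables (p : seq V).
Hypotheses (up : uniq p) (sp : size p = #|V|).
Let f := path_graph p.
Let ix x := index x p.

Let ix_lt x : ix x < #|V|.
Proof. by rewrite -sp index_mem (uniq_full_mem x). Qed.

Let ix_inj : injective ix.
Proof.
move=> x y /(congr1 (nth x p)).
by rewrite !nth_index // (uniq_full_mem _ up sp).
Qed.

Let ix_nth x i : i < #|V| -> ix (nth x p i) = i.
Proof. by move=> il; apply: index_uniq; rewrite ?sp. Qed.

Lemma path_graph_sub e : symmetric e -> sorted e p -> subrel f e.
Proof.
move=> se ep.
have H x y : ix y = (ix x).+1 -> e x y.
  move=> E; have /(sortedP x)/(_ (ix x)) := ep.
  rewrite -E index_mem (uniq_full_mem y) // => /(_ isT).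
  by rewrite !nth_index // (uniq_full_mem _ up sp).
by move=> x y /orP[] /eqP /H //; rewrite se.
Qed.

Lemma path_graph_simple : simple_graph f.
Proof.
split=> [x y|x]; rewrite /f /path_graph; first by rewrite orbC.
by rewrite orbb; apply/eqP; lia.
Qed.

Lemma path_graph_connected : connected f.
Proof.
have [sf _] := path_graph_simple.
have H d x y : ix y = ix x + d -> connect f x y.
  elim: d y => [|d IH] y E.
    by have /ix_inj -> : ix y = ix x by rewrite E addn0.
  have yl := ix_lt y.
  have E' : ix (nth x p (ix x + d)) = ix x + d by rewrite ix_nth //; lia.
  apply: connect_trans (IH _ E') (connect1 _).
  by rewrite /f /path_graph -![index _ p]/(ix _) E' E addnS eqxx.
move=> x y; have [xy|/ltnW yx] := leqP (ix x) (ix y).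
  by apply: (H (ix y - ix x)); lia.
by rewrite (sym_connect_sym sf); apply: (H (ix x - ix y)); lia.
Qed.

(* Both neighbours on a cycle of its vertex of largest index would have to be
   the predecessor of that vertex on the path. *)
Lemma path_graph_acyclic : acyclic f.
Proof.
move=> c c2 /andP[cc uc].
have [x0 x0c] : exists x, x \in c.
  by case: c c2 {cc uc} => // x c _; exists x; rewrite mem_head.
case: (arg_maxnP ix x0c) => x xc mx.
have [i q rc] := rot_to xc.
have inc y : y \in x :: q -> ix y <= ix x by rewrite -rc mem_rot; apply: mx.
rewrite -(rot_cycle i) in cc; rewrite -(rot_uniq i) in uc.
rewrite -(size_rot i) in c2; rewrite {}rc in cc uc c2.
case: q inc cc uc c2 => [|y q] // inc.
case/lastP: q inc => [|q z] // inc cc uc _.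
have ny : ix y <= ix x by apply: inc; rewrite !inE eqxx orbT.
have nz : ix z <= ix x by apply: inc; rewrite !inE mem_rcons mem_head !orbT.
have : y != z.
  move: uc; rewrite /= mem_rcons inE negb_or => /and3P[_ /andP[]] //.
case/negP; apply/eqP/ix_inj.
move: cc; rewrite /= rcons_path last_rcons => /and3P[fxy _ fzx].
move: fxy fzx; rewrite /f /path_graph -/(ix x) -/(ix y) -/(ix z); lia.
Qed.

Lemma path_graph_tree : is_tree f.
Proof.
split; [exact: path_graph_simple|exact: path_graph_connected|].
exact: path_graph_acyclic.
Qed.

Lemma path_graph_leaf x : leaf f x -> ix x = 0 \/ ix x = #|V|.-1.
Proof.
rewrite /leaf => /cards1P[w wE]; have xl := ix_lt x.
have [->|x0] := eqVneq (ix x) 0; first by left.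
have [->|xm] := eqVneq (ix x) #|V|.-1; first by right.
have wP z : f x z -> ix z = ix w.
  by move=> fz; congr ix; apply/set1P; rewrite -wE inE.
(* At an inner position both the predecessor and the successor would be the unique neighbour [w]. *)
have := wP (nth x p (ix x).-1); have := wP (nth x p (ix x).+1).
rewrite /f /path_graph -![index _ p]/(ix _) !ix_nth; lia.
Qed.

(** Each step of a walk changes the index by exactly one. *)
Lemma path_graph_walk x y k :
  walk_of_length f x y k -> ix x <= ix y + k /\ ix y <= ix x + k.
Proof.
case/existsP=> -[q /= /eqP <-] /andP[] + /eqP <-.
elim: q x => [|z q IH] x /=; first by rewrite addn0.
case/andP=> + /IH; rewrite /f /path_graph -/(ix x) -/(ix z); lia.
Qed.

Lemma path_graph_leaf_distance : #|V|.-1 <= leaf_distance f.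
Proof.
rewrite /leaf_distance; elim/big_ind: _ => [|a b ha hb|[x y] lxy].
- exact: leq_pred.
- by rewrite leq_min ha hb.
have [lx ly xy] : [/\ leaf f x, leaf f y & x != y] by apply/and3P.
(* A value of [find] below [#|V|.-1] comes from an actual walk of that length, too short to join the
   two ends of the path. *)
rewrite -[dist _ _ _]/(dist f x y) /dist leqNgt; apply/negP => lt.
have : has (walk_of_length f x y) (iota 0 #|V|).
  by rewrite has_find size_iota; apply: leq_trans lt (leq_pred _).
move=> /(nth_find 0); rewrite nth_iota; last exact: leq_trans lt (leq_pred _).
rewrite add0n => /path_graph_walk; move: lt; set d := find _ _ => lt.
have nxy : ix x <> ix y by move/ix_inj => E; rewrite E eqxx in xy.
move: lt nxy.
by case: (path_graph_leaf lx) (path_graph_leaf ly) => [] -> [] ->; lia.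
Qed.

End PathGraph.

End SpanningPath.

(** * From the edge bound to the spanning path *)

Theorem theorem1p3 (V : finType) (e : rel V) (n t : nat)
  (he : simple_graph e)
  (hconn : connected e)
  (ht : 0 < t)
  (hn : #|V| = n)
  (hn5 : 5 <= n)
  (hdeg : t <= min_degree e)
  (hE1 : n = 5 \/ 6 * t + 1 <= n ->
    (#|edges e|%:R >
       'C(n - t, 2)%:R + 3 / 2 * t%:R ^+ 2 - t%:R + 1 / 2 :> rat)%R)
  (hE2 : 6 <= n <= 6 * t ->
    (#|edges e|%:R >
       'C(n - t, 2)%:R + 3 / 2 * t%:R ^+ 2 + t%:R / 2 :> rat)%R) :
  exists f : rel V, spanning_tree e f /\ 4 <= leaf_distance f.
Proof.
have deg_ge x : t <= degree e x.
  apply: leq_trans hdeg _.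
  by rewrite /min_degree -minEnat -leEnat; apply: bigmin_le.
have tn : t < n.
  have [x _] : exists x : V, x \in V by apply/card_gt0P; rewrite hn; lia.
  by rewrite -hn; apply: leq_ltn_trans (deg_ge x) (degree_lt x he.2).
(* Twice the first edge bound, with [2 * t] moved across to avoid subtraction. The second bound
   exceeds the first because [t >= 1]. *)
have many : (n - t) * (n - t).-1 + 3 * t ^ 2 + 1 < 2 * #|edges e| + 2 * t.
  have C2 : 2 * 'C(n - t, 2) = (n - t) * (n - t).-1.
    by rewrite bin2 mul2n -[RHS]odd_double_half oddM; case: (n - t) => //= m;
      rewrite andNb.
  rewrite -C2 -(ltr_nat rat) !(natrD, natrM, natrX).
  have t1 : (1 <= t%:R :> rat)%R by rewrite ler1n.
  have [nle|nlt] := leqP (6 * t + 1) n.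
    by have := hE1 (or_intror nle); lra.
  have [n5|n5] := eqVneq n 5; first by have := hE1 (or_introl n5); lra.
  have /hE2 : 6 <= n <= 6 * t by lia.
  by lra.
suff /hamiltonian_path_of_cone[p [ep up sp]] : hamiltonian (cone e).
  exists (path_graph p); split; last first.
    by apply: leq_trans (path_graph_leaf_distance up sp); rewrite hn; lia.
  split; first exact: path_graph_sub up sp _ he.1 ep.
  exact: path_graph_tree up sp.
apply: NNPP => nh.
have W3 : 2 < #|{: option V}| by rewrite card_option hn; lia.
(* Coning raises every degree by one, and the apex has degree [n > t]. *)
have [|k []] := nonhamiltonian_degree_sum (d := t.+1) (cone_simple he) W3 nh.
  by case=> [x|]; rewrite ?degree_cone_Some ?degree_cone_None ?hn // ltnS.
rewrite card_option degree_sum_cone hn => tk kn.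
have := double_edges_le he; set S := \sum_x _ => ES H.
have {}many : (n - t) * (n - t).-1 + 3 * t ^ 2 + 1 < S + 2 * t by lia.
(* For n = 2k + b the two bounds on 2 |E| are incompatible, as they differ by
   (k - 2t)^2 + (k - t) + 1 + 2b(k - t) > 0. *)
have [a ka] : exists a, k = t + 1 + a by exists (k - t - 1); lia.
have [b nb] : exists b, n = 2 * k + b by exists (n - 2 * k); lia.
(* This is [(k - 2t)^2 >= 0] without subtraction, as [k - 2t = (a + 1) - t]. *)
have sq := (nat_Cauchy t (a + 1)).1.
have nt : n - t = t + 2 + 2 * a + b by lia.
have nt1 : (n - t).-1 = t + 1 + 2 * a + b by lia.
move: many H sq; rewrite nt1 nt nb ka -!mulnn; clear; lia.
Qed.
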